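(* For every ordered graph $F$, $\rho_{<}(F) = 0$ if and only if $F$ does not contain a monotone path of length two, i.e. there are no vertices $u<v<w$ of $F$ with $uv$ and $vw$ both edges of $F$.
   Context: An ordered graph is a graph whose vertex set carries a total order. An ordered graph $G$ contains an ordered graph $F$ if there is an injective order-preserving map $V(F)\to V(G)$ sending edges of $F$ to edges of $G$; otherwise $G$ is $F$-free. For ordered graphs $F,G$ (with $e(G)>0$), $\rho_{<}(F,G)=\max\{e(G')/e(G): G'\subseteq G,\ G'\ F\text{-free}\}$, and the relative Turán density is $\rho_{<}(F)=\inf_G\rho_{<}(F,G)$ over all ordered graphs $G$. *)

(* Defs.v *)
From HB Require Import structures.
From mathcomp Require Import all_boot all_order all_algebra.
From mathcomp Require Import all_classical all_reals.
Set Implicit Arguments. Unset Strict Implicit. Unset Printing Implicit Defensive.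
Import Order.TTheory GRing.Theory Num.Theory.

(* An ordered graph: vertex set 'I_nv with its natural (total) order; every
   finite totally ordered set is order-isomorphic to some 'I_n.  An edge {i,j}
   with i < j is stored as the pair (i, j). *)
Record ograph := OGraph {
  nv : nat;
  edges : {set 'I_nv * 'I_nv};
  edges_wf : [forall e in edges, (e.1 < e.2)%N]
}.

Definition e_num (G : ograph) : nat := #|edges G|.

Definition contains (F : ograph) (n : nat) (E : {set 'I_n * 'I_n}) : bool :=
  [exists f : {ffun 'I_(nv F) -> 'I_n},
     [forall i : 'I_(nv F), forall j : 'I_(nv F), (i < j)%N ==> (f i < f j)%N]
     && [forall e in edges F, (f e.1, f e.2) \in E]].

Definition ex_rel (F G : ograph) : nat :=
  \max_(E in powerset (edges G) | ~~ contains F E) #|E|.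

Definition rho_FG (R : realType) (F G : ograph) : R :=
  ((ex_rel F G)%:R / (e_num G)%:R)%R.

Definition rho (R : realType) (F : ograph) : R :=
  inf [set r : R | exists G : ograph, (0 < e_num G)%N /\ r = rho_FG R F G].

Definition has_monotone_P2 (F : ograph) : Prop :=
  exists u v w : 'I_(nv F),
    [/\ (u < v)%N, (v < w)%N, (u, v) \in edges F & (v, w) \in edges F].

(* Main.v *)
(* A uniformly random vertex bipartition directs a quarter of the edges from the
   first class to the second, and these edges contain no monotone path of length
   two; hence the density is at least 1/4 when F contains such a path.

   Otherwise let G have as vertices the nodes of the m-ary tree of depth L in
   preorder, each leaf being joined to all its proper ancestors, so that there
   are L m^L edges.  Let E be an F-free set of edges and k the order of F.  Sort
   the leaves v by the set S of levels at which E joins v to its ancestor.  If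
   more than L m^(L-1) leaves share the same S, then one of them, u, has at every
   level another such leaf branching off to its left; when |S| >= k, the ancestors
   of u at levels in S and these leaves form a half graph
   a_1 < b_1 < a_2 < b_2 < ..., with a_i joined to b_j for i <= j, in which F
   embeds.  Hence |E| <= k m^L + 2^L L (L m^(L-1)), which is (k + 1) m^L for
   m = 2^L L^2, and the density is at most (k + 1) / L. *)
Require Import Defs.
From mathcomp Require Import all_boot all_order all_algebra.
From mathcomp Require Import all_classical all_reals.
From mathcomp Require Import zify.
Set Implicit Arguments. Unset Strict Implicit. Unset Printing Implicit Defensive.
Import Order.TTheory GRing.Theory Num.Theory.

Lemma edge_lt (G : ograph) (e : 'I_(nv G) * 'I_(nv G)) :
  e \in edges G -> e.1 < e.2.
Proof. by move=> eG; move/forall_inP: (edges_wf G) => /(_ _ eG). Qed.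

(** * Directed cuts *)

Definition dicut (G : ograph) (c : {ffun 'I_(nv G) -> bool}) :=
  [set e in edges G | c e.1 && ~~ c e.2].

Lemma dicut_free (F G : ograph) (c : {ffun 'I_(nv G) -> bool}) :
  has_monotone_P2 F -> ~~ contains F (dicut c).
Proof.
move=> [u [v [w [_ _ uv vw]]]]; apply/existsP => -[f /andP[_ /forall_inP fE]].
by move: (fE _ uv) (fE _ vw); rewrite !inE /= => /and3P[_ _ /negPf->] /andP[].
Qed.

Definition toggle n (x : 'I_n) (c : {ffun 'I_n -> bool}) :=
  [ffun y => c y (+) (y == x)].

Lemma toggleK n (x : 'I_n) : involutive (toggle x).
Proof. by move=> c; apply/ffunP => y; rewrite !ffunE -addbA addbb addbF. Qed.

Lemma sum_separating n (u v : 'I_n) : u != v ->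
  4 * (\sum_(c : {ffun 'I_n -> bool}) (c u && ~~ c v)) = 2 ^ n.
Proof.
move=> uv; pose d (c : {ffun 'I_n -> bool}) : nat := c u && ~~ c v.
have tog (x : 'I_n) (g : {ffun 'I_n -> bool} -> nat) :
    \sum_c g (toggle x c) = \sum_c g c.
  by rewrite [RHS](reindex_inj (inv_inj (toggleK x))).
(* Toggling [u] and [v] runs through all four colourings of the pair, exactly
   one of which separates it in the right direction. *)
transitivity (\sum_c (d c + d (toggle u c) + d (toggle v c)
                      + d (toggle v (toggle u c)))).
  rewrite !big_split /= (tog u d) (tog v d) (tog u (d \o toggle v)) (tog v d).
  by rewrite !mulSn mul0n addn0 !addnA.
rewrite (eq_bigr (fun=> 1)) => [|c _].
  by rewrite sum1_card card_ffun card_bool card_ord.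
rewrite /d !ffunE !eqxx (negPf uv) (eq_sym v u) (negPf uv).
by case: (c u); case: (c v).
Qed.

(** Averaging over all colourings: each edge is cut by a quarter of them. *)
Lemma big_dicut (G : ograph) :
  exists c : {ffun 'I_(nv G) -> bool}, e_num G <= 4 * #|dicut c|.
Proof.
apply/existsP; apply: contraT; rewrite negb_exists => /forallP small.
have: \sum_(c : {ffun 'I_(nv G) -> bool}) 4 * #|dicut c| = e_num G * 2 ^ nv G.
  transitivity (\sum_(e in edges G)
      4 * \sum_(c : {ffun 'I_(nv G) -> bool}) (c e.1 && ~~ c e.2)).
    under [RHS]eq_bigr do rewrite big_distrr /=.
    rewrite exchange_big /=; apply: eq_bigr => c _.
    rewrite -big_distrr -sum1_card big_mkcond [in RHS]big_mkcond /=.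
    congr (4 * _); apply: eq_bigr => e _; rewrite inE.
    by case: (e \in edges G) => //=; case: (_ && _).
  rewrite (eq_bigr (fun=> 2 ^ nv G)) ?sum_nat_const // => e /edge_lt lt_e.
  by apply: sum_separating; rewrite neq_ltn lt_e.
have: \sum_(c : {ffun 'I_(nv G) -> bool}) (4 * #|dicut c|).+1
      <= \sum_(c : {ffun 'I_(nv G) -> bool}) e_num G.
  by apply: leq_sum => c _; rewrite ltnNge small.
under eq_bigr do rewrite -addn1.
rewrite big_split /= sum1_card sum_nat_const card_ffun card_bool card_ord.
have := expn_gt0 2 (nv G); lia.
Qed.

(** * The tree graph and its branching leaves *)

Section TreeGraph.

Variables m L : nat.

Local Notation M := (m ^ L).

(** The leftmost leaf below the ancestor of [v] at height [t]; levels count up from the leaves. *)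
Definition block (t v : nat) := v %/ m ^ t * m ^ t.

Lemma block_le t v : block t v <= v.
Proof. exact: leq_trunc_div. Qed.

Lemma leq_block s t v : s <= t -> block t v <= block s v.
Proof.
move=> st; rewrite /block -(subnKC st) expnD divnMA mulnCA [leqRHS]mulnC.
by rewrite leq_mul2l leq_trunc_div orbT.
Qed.

(* Positions realise the preorder of the [m]-ary tree with leaves [0 .. m^L - 1].
   An internal node whose leaves form a block of length [m ^ t.+1] sits in front
   of the leftmost of them; the residue modulo [L.+1] keeps positions distinct. *)
Lemma node_subproof (t : 'I_L) (v : 'I_M) : block t.+1 v * L.+1 + t < M * L.+1.
Proof.
have := block_le t.+1 v; have := ltn_ord v; have := ltn_ord t; nia.
Qed.

Lemma leaf_subproof (v : 'I_M) : v * L.+1 + L < M * L.+1.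
Proof. have := ltn_ord v; nia. Qed.

Definition node (t : 'I_L) (v : 'I_M) := Ordinal (node_subproof t v).
Definition leaf (v : 'I_M) := Ordinal (leaf_subproof v).

Definition tree_edge (p : 'I_M * 'I_L) := (node p.2 p.1, leaf p.1).

Lemma tree_edge_inj : injective tree_edge.
Proof.
move=> [v s] [w t] [/= e1 e2].
have vw : v = w by apply: val_inj => /=; nia.
congr (_, _) => //; apply: val_inj => /=; move/(congr1 (modn^~ L.+1)): e1.
by rewrite !modnMDl !modn_small // ltnS ltnW.
Qed.

Lemma tree_edges_wf :
  [forall e in tree_edge @: [set: 'I_M * 'I_L], (e.1 < e.2)%N].
Proof.
apply/forall_inP => _ /imsetP[[v t] _ ->] /=.
by have := block_le t.+1 v; have := ltn_ord t; nia.
Qed.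

Definition tree_graph := OGraph tree_edges_wf.

Lemma tree_graph_e_num : e_num tree_graph = L * M.
Proof.
rewrite /e_num card_imset; last exact: tree_edge_inj.
by rewrite cardsT card_prod !card_ord mulnC.
Qed.

Hypothesis m_gt0 : 0 < m.
Variable V : {set 'I_M}.

(* Some leaf of [V] lies below the level-[t] ancestor of [u], in an earlier
   child of it than [u]. *)
Definition branching (t : 'I_L) (u : 'I_M) :=
  [exists v in V, (v %/ m ^ t.+1 == u %/ m ^ t.+1) && (v %/ m ^ t < u %/ m ^ t)].

(* Below a given node, all non-branching leaves of [V] sit under the first child
   that meets [V]. *)
Lemma card_nonbranching t : #|[set u in V | ~~ branching t u]| <= m ^ L.-1.
Proof.
have mt s : 0 < m ^ s by rewrite expn_gt0 m_gt0.
have ML : M = m ^ (L.-1 - t) * m ^ t.+1.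
  by rewrite -expnD; congr (_ ^ _); have := ltn_ord t; lia.
have p1 (u : 'I_M) : u %/ m ^ t.+1 < m ^ (L.-1 - t).
  by rewrite ltn_divLR // -ML.
have p2 (u : 'I_M) : u %% m ^ t < m ^ t by rewrite ltn_mod.
(* [h] forgets only the base-[m] digit of [u] at place [t]. *)
pose h u := (Ordinal (p1 u), Ordinal (p2 u)).
have -> : m ^ L.-1 = #|{: 'I_(m ^ (L.-1 - t)) * 'I_(m ^ t)}|.
  rewrite card_prod !card_ord -expnD; congr (_ ^ _); have := ltn_ord t; lia.
have h_inj : {in [set u in V | ~~ branching t u] &, injective h}.
  move=> u v /[!inE] /andP[uV nu] /andP[vV nv] [e1 e2].
  apply: ord_inj; rewrite (divn_eq u (m ^ t)) (divn_eq v (m ^ t)) e2.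
  congr (_ * _ + _); case: (ssrnat.ltngtP (u %/ m ^ t) (v %/ m ^ t)) => // lt.
    by case/existsP: nv; exists u; rewrite uV e1 eqxx lt.
  by case/existsP: nu; exists v; rewrite vV e1 eqxx lt.
by rewrite -(card_in_imset h_inj) max_card.
Qed.

Lemma exists_branching :
  L * m ^ L.-1 < #|V| -> exists2 u, u \in V & forall t, branching t u.
Proof.
move=> bigV; have [/exists_inP[u uV /forallP]|] :=
  boolP [exists u in V, forall t, branching t u]; first by exists u.
rewrite negb_exists_in => /forall_inP none.
suff: #|V| <= L * m ^ L.-1 by rewrite leqNgt bigV.
apply: (@leq_trans #|\bigcup_(t : 'I_L) [set u in V | ~~ branching t u]|).
  apply/subset_leq_card/fintype.subsetP => u uV.
  have /forallPn[t nt] := none u uV.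
  by apply/finset.bigcupP; exists t => //; rewrite inE uV.
apply: (@leq_trans (\sum_(t < L) m ^ L.-1)).
  elim/big_ind2: _ => [|A a B b Aa Bb|t _]; first by rewrite cards0.
    by apply: leq_trans (leq_add Aa Bb); apply: leq_card_setU.
  exact: card_nonbranching.
by rewrite sum_nat_const card_ord.
Qed.

End TreeGraph.

(** * Half graphs in the tree graph *)

Lemma exists_decreasing_enum L (S : {set 'I_L.+1}) k : k <= #|S| ->
  exists t : nat -> 'I_L.+1,
    (forall i, i < k -> t i \in S) /\ (forall i j, i < j < k -> t j < t i).
Proof.
move=> kS; pose s := rev (enum S).
have sz : k <= size s by rewrite size_rev -cardE.
have srt : sorted (fun x y : 'I_L.+1 => y < x) s.
  rewrite rev_sorted; apply: sorted_filter.
    by move=> x y z; apply: ssrnat.ltn_trans.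
  by have := iota_ltn_sorted 0 L.+1; rewrite -val_enum_ord sorted_map enumT.
exists (nth ord0 s); split=> [i ik|i j /andP[ij jk]].
  by rewrite -mem_enum -mem_rev mem_nth // (leq_trans ik).
have tr : transitive (fun x y : 'I_L.+1 => y < x).
  by move=> x y z yx xz; apply: ltn_trans xz yx.
apply: (sorted_ltn_nth tr) => //; rewrite inE; apply: leq_trans sz => //.
exact: ssrnat.ltn_trans jk.
Qed.

Lemma contains_of_common_levels m L (F : ograph) (S : {set 'I_L.+1})
    (V : {set 'I_(m ^ L.+1)}) (E : {set _ * _}) :
    0 < m -> ~ has_monotone_P2 F -> nv F <= #|S| -> L.+1 * m ^ L < #|V| ->
    (forall v t, v \in V -> t \in S -> tree_edge (v, t) \in E) ->
  contains F E.
Proof.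
move=> m_gt0 noP2 /exists_decreasing_enum[t [tS t_dec]] bigV VSE.
have mt s : 0 < m ^ s by rewrite expn_gt0 m_gt0.
have [u uV u_br] := exists_branching m_gt0 bigV.
have [|b bP] := @fin_all_exists 'I_L.+1 _ (fun s v => [/\ v \in V,
    v %/ m ^ s.+1 = u %/ m ^ s.+1 & v < block m s u]).
  move=> s; have /exists_inP[v vV /andP[/eqP vu lt_vu]] := u_br s.
  by exists v; split; rewrite // -ltn_divLR.
(* Every vertex of F has edges to one side only: sources go to ancestors of [u],
   the others to leaves branching off to the left of [u], so that along
   decreasing levels ancestor and leaf alternate in the order. *)
pose source i := [exists j, (i, j) \in edges F].
pose f := [ffun i : 'I_(nv F) =>
  if source i then node (t i) u else leaf (b (t i))].
have b_ge (s : 'I_L.+1) : block m s.+1 u <= b s.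
  by have [_ bu _] := bP s; rewrite /block -bu leq_trunc_div.
(* Up to scaling, [f i] lies in the interval from [block m (t i).+1 u] to [block m (t i) u]; these
   are disjoint and move right as [t i] decreases. *)
have lo (i : 'I_(nv F)) : block m (t i).+1 u * L.+2 <= f i.
  by rewrite ffunE; case: ifP => _ /=; have := b_ge (t i); nia.
have hi (i : 'I_(nv F)) : f i < block m (t i) u * L.+2.
  have [_ _ lt_b] := bP (t i); have := b_ge (t i).
  by rewrite ffunE; case: ifP => _ /=; have := ltn_ord (t i); nia.
apply/existsP; exists f; apply/andP; split.
  apply/forallP => i; apply/forallP => j; apply/implyP => ij.
  apply: (leq_trans (hi i)); apply: leq_trans (lo j).
  rewrite leq_mul2r leq_block //.
  by apply: t_dec; rewrite ij /=.
apply/forall_inP => -[i j] ijF /=.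
have ij := edge_lt ijF.
have src_i : source i by apply/existsP; exists j.
have snk_j : source j = false.
  apply/negbTE/negP => /existsP[k jk]; apply: noP2; exists i, j, k.
  by split=> //; apply: (edge_lt jk).
have [bV bu _] := bP (t j).
have lt_t : t j < t i by apply: t_dec; rewrite ij /=.
rewrite !ffunE src_i snk_j.
(* [b (t j)] parts from [u] at the lower level [t j], so both share their ancestor at level
   [t i]. *)
suff -> : node (t i) u = node (t i) (b (t j)) by apply: VSE; rewrite ?tS.
apply: val_inj; rewrite /= /block.
have -> : m ^ (t i).+1 = m ^ (t j).+1 * m ^ (t i - t j).
  by rewrite -expnD; congr (_ ^ _); lia.
by rewrite !divnMA bu.
Qed.

Lemma card_free_tree_subgraph m L (F : ograph)
    (E : {set 'I_(nv (tree_graph m L.+1)) * 'I_(nv (tree_graph m L.+1))}) :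
    0 < m -> ~ has_monotone_P2 F -> E \subset edges (tree_graph m L.+1) ->
    ~~ contains F E ->
  #|E| <= nv F * m ^ L.+1 + 2 ^ L.+1 * (L.+1 * (L.+1 * m ^ L)).
Proof.
move=> m_gt0 noP2 EG Efree.
pose B (v : 'I_(m ^ L.+1)) := [set t : 'I_L.+1 | tree_edge (v, t) \in E].
pose V S := [set v | B v == S].
have smallV (S : {set 'I_L.+1}) : nv F <= #|S| -> #|V S| <= L.+1 * m ^ L.
  move=> kS; rewrite leqNgt; apply: contra Efree => bigV.
  apply: (contains_of_common_levels m_gt0 noP2 kS bigV) => v t.
  by rewrite inE => /eqP <-; rewrite inE.
have -> : #|E| = \sum_v #|B v|.
  have -> : E = @tree_edge m L.+1 @: [set p | tree_edge p \in E].
    apply/setP => e; apply/idP/imsetP => [eE|[p /[!inE] pE ->] //].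
    have /imsetP[p _ ep] := fintype.subsetP EG e eE.
    by exists p; rewrite ?inE -?ep.
  rewrite card_imset; last exact: tree_edge_inj.
  transitivity (\sum_v \sum_t (tree_edge (v, t) \in E)).
    rewrite pair_bigA /= -sum1_card big_mkcond; apply: eq_bigr => -[v t] _.
    by rewrite inE; case: (_ \in _).
  apply: eq_bigr => v _; rewrite -sum1_card [RHS]big_mkcond.
  by apply: eq_bigr => t _; rewrite inE; case: (_ \in _).
(* A leaf with fewer than [nv F] levels costs at most [nv F]; any other costs at most [L.+1],
   charged to its own level set [S]. *)
apply: (@leq_trans (\sum_v (nv F +
    \sum_(S : {set 'I_L.+1} | nv F <= #|S|) (B v == S) * L.+1))).
  apply: leq_sum => v _; have [kB|Bk] := leqP (nv F) #|B v|; last first.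
    by rewrite (leq_trans (ltnW Bk)) ?leq_addr.
  rewrite (bigD1 (B v)) //= eqxx mul1n addnCA.
  by rewrite (leq_trans (max_card _)) // card_ord leq_addr.
rewrite big_split /= sum_nat_const card_ord mulnC leq_add2l exchange_big /=.
apply: (@leq_trans (\sum_(S : {set 'I_L.+1}) L.+1 * (L.+1 * m ^ L))).
  rewrite big_mkcond; apply: leq_sum => S _; case: ifP => // kS.
  rewrite -big_distrl /= [leqLHS]mulnC leq_mul2l /=.
  apply: leq_trans (smallV S kS).
  rewrite -sum1_card [leqRHS]big_mkcond; apply: leq_sum => v _.
  by rewrite inE; case: (_ == _).
by rewrite sum_nat_const -cardsT -powersetT card_powerset cardsT card_ord.
Qed.

(** * Bounds on the density *)

Local Open Scope ring_scope.

Lemma rho_FG_ge0 (R : realType) (F G : ograph) : 0 <= rho_FG R F G.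
Proof. by rewrite divr_ge0. Qed.

Lemma rho_le (R : realType) (F G : ograph) :
  (0 < e_num G)%N -> rho R F <= rho_FG R F G.
Proof.
move=> G_gt0; apply: ge_inf; last by exists G.
by exists 0 => _ [H [_ ->]]; apply: rho_FG_ge0.
Qed.

Lemma le_rho (R : realType) (F : ograph) (x : R) :
  (forall G, (0 < e_num G)%N -> x <= rho_FG R F G) -> x <= rho R F.
Proof.
move=> xG; apply: lb_le_inf => [|_ [G [G_gt0 ->]]]; last exact: xG.
(* A graph with a single edge shows that the infimum is over a nonempty set. *)
have G_gt0 : (0 < e_num (tree_graph 1 1))%N by rewrite tree_graph_e_num.
by exists (rho_FG R F (tree_graph 1 1)), (tree_graph 1 1).
Qed.

Lemma rho_monotone_P2 (R : realType) (F : ograph) :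
  has_monotone_P2 F -> 4^-1 <= rho R F.
Proof.
move=> FP2; apply: le_rho => G G_gt0; have [c big_c] := big_dicut G.
rewrite /rho_FG ler_pdivlMr ?ltr0n // mulrC ler_pdivrMr // -natrM ler_nat mulnC.
apply: (leq_trans big_c); rewrite leq_mul2l /=.
rewrite /ex_rel; apply: leq_bigmax_cond.
rewrite dicut_free // andbT powersetE.
by apply/fintype.subsetP => e /[!inE] /andP[].
Qed.

Lemma rho_no_monotone_P2 (R : realType) (F : ograph) (L : nat) :
  ~ has_monotone_P2 F -> rho R F <= (nv F).+1%:R / L.+1%:R.
Proof.
move=> noP2; pose m := (2 ^ L.+1 * (L.+1 * L.+1))%N.
have m_gt0 : (0 < m)%N by rewrite !muln_gt0 expn_gt0.
have mL_gt0 : (0 < m ^ L.+1)%N by rewrite expn_gt0 m_gt0.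
have G_e := tree_graph_e_num m L.+1.
apply: (le_trans (@rho_le R F (tree_graph m L.+1) _)).
  by rewrite G_e muln_gt0.
rewrite /rho_FG G_e ler_pdivrMr ?ltr0n ?muln_gt0 // natrM mulrA.
rewrite divfK ?pnatr_eq0 // -natrM ler_nat.
apply/bigmax_leqP => E /andP[]; rewrite powersetE => EG Efree.
apply: (leq_trans (card_free_tree_subgraph m_gt0 noP2 EG Efree)).
by rewrite expnS /m; lia.
Qed.

Theorem theorem1p3 (R : realType) (F : ograph) :
  rho R F = 0%R <-> ~ has_monotone_P2 F.
Proof.
split=> [rho0 /(rho_monotone_P2 R)|noP2].
  by rewrite rho0 invr_le0 lern0.
apply/eqP; rewrite eq_le le_rho ?andbT; last by move=> G _; apply: rho_FG_ge0.
apply/ler_addgt0Pl => e e_gt0; rewrite addr0.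
have [n] := ltr_add_invr (divr_gt0 e_gt0 (ltr0Sn R (nv F))).
rewrite add0r ltr_pdivlMr ?ltr0n // mulrC => /ltW; apply: le_trans.
exact: rho_no_monotone_P2.
Qed.
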